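(* Let $\mathbf u$ be an $\varepsilon_0$-local minimizer of $J$ in $\mathbb A$, and assume that for every $x\in\Gamma_{\Sigma,\mathrm{ND}}(\mathbf u)$ there is $R_x>0$ with $\mathscr C_{\mathbf u}(x;r)\ne\varnothing$ for every $0<r<R_x$. Let $x_0\in\Gamma_{\rm mp}^{\rm nb}(\mathbf u)$ and let $\mathbf u_0$ be a blow-up limit of $\mathbf u$ at $x_0$. Assume that $\Omega_0=\{|\mathbf u_0|>0\}$ is connected, and write $\mathbf u_0=\mathbf a v_0$ with $v_0=|\mathbf u_0|$ and $\mathbf a=(a_1,\dots,a_m)$ the unique unit vector with nonnegative entries for which this holds. Define $\operatorname{spt}\mathbf a:=\{i\in\{1,\dots,m\}:a_i>0\}$. Then $\mathcal I_{\mathbf u_0}(0)=\operatorname{spt}\mathbf a$ and $\mathbf u_0(x)=\mathbf a v_0(x)$. Moreover, $\partial\Omega_{u_{0,i}}=\partial\Omega_0$ for every $i\in\operatorname{spt}\mathbf a$, whereas $u_{0,i}\equiv0$ for every $i\notin\operatorname{spt}\mathbf a$.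
   Context: Fix integers $n\ge2$, $m\ge1$ and a constant $\gamma>0$. $D\subset\mathbb R^n$ is a bounded open set. A Dini modulus on $[0,a]$ is a nondecreasing $\omega:[0,a]\to[0,\infty)$ with $\omega(0)=0$ and $\int_0^a\omega(t)/t\,dt<\infty$. $\Sigma\subset\mathbb R^n$ is a given nonempty closed embedded hypersurface of class $C^{1,\mathrm{Dini}}$: it is a $C^1$ hypersurface and at every $x\in\Sigma$ there are an orthonormal coordinate system centered at $x$ with $T_x\Sigma=\mathbb R^{n-1}\times\{0\}$, a radius $r_x>0$, a Dini modulus $\omega_x$ on $[0,2r_x]$ and $f_x\in C^1(B'_{r_x}(0))$ ($B'_r(0)$ the ball in $\mathbb R^{n-1}$) with $f_x(0)=0$, $\nabla f_x(0)=0$, $|\nabla f_x(y)-\nabla f_x(z)|\le\omega_x(|y-z|)$, and $\Sigma\cap(B'_{r_x}(0)\times(-r_x,r_x))=\{(y,f_x(y)):y\in B'_{r_x}(0)\}$. Write $\mathsf d_\Sigma(x)=\mathrm{dist}(x,\Sigma)$ and $Q(x)=\mathsf d_\Sigma(x)^\gamma$. For $\mathbf v=(v_1,\dots,v_m)$ let $\Omega_{\mathbf v}:=\{|\mathbf v|>0\}$, $\Omega_{v_i}:=\{v_i>0\}$ and $J(\mathbf v;E):=\int_E\big(|\nabla\mathbf v|^2+\mathsf d_\Sigma^{2\gamma}\chi_{\Omega_{\mathbf v}}\big)\,dx$. Given $\mathbf g\in W^{1,2}(D;\mathbb R^m)$ with $g_i\ge0$ a.e., let $\mathbb A:=\{\mathbf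 v\in W^{1,2}(D;\mathbb R^m):\mathbf v-\mathbf g\in W^{1,2}_0(D;\mathbb R^m),\ v_i\ge0\text{ a.e. for all }i\}$. $\mathbf u\in\mathbb A$ is an $\varepsilon_0$-local minimizer ($\varepsilon_0>0$) if $J(\mathbf u;D)\le J(\mathbf v;D)$ for every $\mathbf v\in\mathbb A$ with $\|\nabla(\mathbf u-\mathbf v)\|_{L^2(D)}^2+\|\chi_{\Omega_{\mathbf u}}-\chi_{\Omega_{\mathbf v}}\|_{L^1(D)}<\varepsilon_0$. Local minimizers are identified with their continuous representatives, so $\Omega_{\mathbf u}$ is open. $\Gamma_\Sigma(\mathbf u):=\partial\Omega_{\mathbf u}\cap\Sigma\cap D$; for $x_0\in\Gamma_\Sigma(\mathbf u)$ the limit $\Theta_\Sigma(\mathbf u;x_0,0^+)=\lim_{r\to0^+}r^{-n-2\gamma}\int_{B_r(x_0)}\mathsf d_\Sigma^{2\gamma}\chi_{\Omega_{\mathbf u}}\,dx$ exists, and $\Gamma_{\Sigma,\mathrm{ND}}(\mathbf u):=\{x_0\in\Gamma_\Sigma(\mathbf u):\Theta_\Sigma(\mathbf u;x_0,0^+)>0\}$. For $x_0\in\Gamma_{\Sigma,\mathrm{ND}}(\mathbf u)$: $\mathscr C_{\mathbf u}(x_0;r)$ is the collection of connected components $\mathcal O$ of $\Omega_{\mathbf u}\cap B_r(x_0)$ with $x_0\in\partial\mathcal O$; $I_{\mathbf u}(\mathcal O):=\{i:u_i>0\text{ in }\mathcal O\}$; $\mathcal I_{\mathbf u}(x_0,r):=\bigcup_{\mathcal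 O\in\mathscr C_{\mathbf u}(x_0;r)}I_{\mathbf u}(\mathcal O)$. Under the nonemptiness assumption in the claim there exist $r_{x_0}>0$ (with $4r_{x_0}<\min\{R_{x_0},\mathrm{dist}(x_0,\partial D)\}$) and a nonempty set $\mathcal I_{\mathbf u}(x_0)\subset\{1,\dots,m\}$ with $\mathcal I_{\mathbf u}(x_0,r)=\mathcal I_{\mathbf u}(x_0)$ for every $0<r<r_{x_0}$; these are fixed. For distinct $i,j\in\mathcal I_{\mathbf u}(x_0)$, $\triangle_{i,j}(x_0,r):=(\partial\Omega_{u_i}\triangle\partial\Omega_{u_j})\cap B_r(x_0)$ (symmetric difference). $\Gamma_{\rm mp}^{\rm nb}(\mathbf u)$ is the set of $x_0\in\Gamma_{\Sigma,\mathrm{ND}}(\mathbf u)$ with $\#\mathcal I_{\mathbf u}(x_0)\ge2$ for which there is $0<r<r_{x_0}$ with $\triangle_{i,j}(x_0,r)=\varnothing$ for all distinct $i,j\in\mathcal I_{\mathbf u}(x_0)$. A blow-up limit of $\mathbf u$ at $x_0$ is a map $\mathbf u_0=(u_{0,1},\dots,u_{0,m})$ on $\mathbb R^n$ that is the limit, strongly in $W^{1,2}_{\rm loc}(\mathbb R^n;\mathbb R^m)$ and locally uniformly, of $\mathbf u_{x_0,r_j}(x):=r_j^{-(1+\gamma)}\mathbf u(x_0+r_jx)$ for some $r_j\to0^+$. (At $x_0\in\Gamma_{\Sigma,\mathrm{ND}}(\mathbf u)$ blow-up limits are nontrivial, and when $\Omega_0$ is connected a unique unit vector $\mathbf a$ with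 nonnegative entries and $\mathbf u_0=\mathbf a|\mathbf u_0|$ exists.) For such $\mathbf u_0$, $\mathcal I_{\mathbf u_0}(0):=\{i\in\{1,\dots,m\}:u_{0,i}\not\equiv0\}$. *)

(* Defs.v *)
From HB Require Import structures.
From mathcomp Require Import all_boot all_order all_algebra.
From mathcomp Require Import all_classical all_reals all_analysis.

Set Implicit Arguments.
Unset Strict Implicit.
Unset Printing Implicit Defensive.

Import Order.TTheory GRing.Theory Num.Theory.
Import numFieldNormedType.Exports.

Local Open Scope classical_set_scope.
Local Open Scope ring_scope.

(* The library norm on 'rV[R]_n is the sup norm (it induces the usual
   topology), hence the explicit Euclidean norm below. *)
Definition enorm (R : realType) n (x : 'rV[R]_n) : R :=
  Num.sqrt (\sum_(i < n) x 0 i ^+ 2).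

Definition eball (R : realType) n (x : 'rV[R]_n) (r : R) : set 'rV[R]_n :=
  [set y | enorm (y - x) < r].

Definition dist_to (R : realType) n (x : 'rV[R]_n) (A : set 'rV[R]_n) : R :=
  inf [set enorm (x - y) | y in A].

Definition bdry (T : topologicalType) (A : set T) : set T :=
  closure A `\` interior A.

Section lebesgue_outer_measure.
Context (R : realType) (n : nat).
Local Open Scope ereal_scope.

Definition box (a b : 'rV[R]_n) : set 'rV[R]_n :=
  [set x | forall i, (a 0 i <= x 0 i <= b 0 i)%R].

(* The volume of the smallest closed box containing A; +oo if A is unbounded. *)
Definition box_volume (A : set 'rV[R]_n) : \bar R :=
  if A == set0 then 0 else
  ereal_inf [set (\prod_(i < n) (p.2 0 i - p.1 0 i))%:E |
             p in [set p : 'rV[R]_n * 'rV[R]_n | A `<=` box p.1 p.2]].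

Definition leb_outer (X : set 'rV[R]_n) : \bar R :=
  ereal_inf [set \sum_(k <oo) box_volume (A k) |
             A in [set A : (set 'rV[R]_n)^nat | X `<=` \bigcup_k A k]].

Lemma box_volume0 : box_volume set0 = 0.
Proof. by rewrite /box_volume eqxx. Qed.

Lemma box_volume_ge0 A : 0 <= box_volume A.
Proof.
rewrite /box_volume; case: ifPn => // /set0P[x Ax].
apply: le_ereal_inf_tmp => _ [[a b] /= Aab <-]; rewrite lee_fin.
apply: prodr_ge0 => i _; have /andP[ax xb] := Aab x Ax i.
by rewrite subr_ge0 (le_trans ax xb).
Qed.

Let leb_outerE : leb_outer =
  @mu_ext _ (g_sigma_algebraType [set: set 'rV[R]_n]) R box_volume.
Proof.
apply/funext => X; congr (ereal_inf _); apply/seteqP; split.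
  by move=> _ [A XA <-]; exists A => //; split => // i; exact: sub_sigma_algebra.
by move=> _ [A [_ XA] <-]; exists A.
Qed.

Let leb_outer0 : leb_outer set0 = 0.
Proof.
rewrite leb_outerE; apply: mu_ext0; [exact: box_volume0|exact: box_volume_ge0].
Qed.

Let leb_outer_ge0 X : 0 <= leb_outer X.
Proof. by rewrite leb_outerE; apply: mu_ext_ge0; exact: box_volume_ge0. Qed.

Let le_leb_outer : {homo leb_outer : A B / A `<=` B >-> A <= B}.
Proof. by move=> A B AB; rewrite leb_outerE; exact: le_mu_ext. Qed.

Let leb_outer_sigma_subadditive : sigma_subadditive leb_outer.
Proof.
rewrite leb_outerE.
exact: (@mu_ext_sigma_subadditive _ (g_sigma_algebraType [set: set 'rV[R]_n])
  R box_volume box_volume_ge0).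
Qed.

HB.instance Definition _ := isOuterMeasure.Build R 'rV[R]_n leb_outer
  leb_outer0 leb_outer_ge0 le_leb_outer leb_outer_sigma_subadditive.

(* A copy of R^n whose measurable sets are the (complete) Lebesgue ones. *)
Definition lebT := caratheodory_type leb_outer.
HB.instance Definition _ := Measurable.on lebT.

Definition leb : set lebT -> \bar R := leb_outer.
HB.instance Definition _ := isMeasure.Build _ lebT R leb
  (@caratheodory_measure0 R _ leb_outer)
  (@caratheodory_measure_ge0 R _ leb_outer)
  (@caratheodory_measure_sigma_additive R _ leb_outer).

End lebesgue_outer_measure.

Arguments leb {R n}.

Section calculus.
Context (R : realType) (n : nat).
Implicit Types (D U K : set 'rV[R]_n) (f g phi : 'rV[R]_n -> R) (i : 'I_n).

Definition partial i f (x : 'rV[R]_n) : R := 'D_(delta_mx 0 i) f x.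

Definition grad f (x : 'rV[R]_n) : 'rV[R]_n := \row_i partial i f x.

Definition C1_on U f :=
  forall x, U x -> differentiable f x /\ forall i, {for x, continuous (partial i f)}.

Definition smooth f :=
  forall (s : seq 'I_n) x, differentiable (foldr partial f s) x.

Definition test_function D phi :=
  smooth phi /\
  exists K, [/\ compact K, K `<=` D & forall x, ~ K x -> phi x = 0].

Definition L1loc D f :=
  forall K, compact K -> K `<=` D ->
    (@leb R n).-integrable K (EFin \o f : lebT R n -> \bar R).

Definition L2 D f :=
  measurable_fun (D : set (lebT R n)) (f : lebT R n -> R) /\
  (\int[leb]_(x in D) (f x ^+ 2)%:E < +oo)%E.

Definition weak_partial D i f g :=
  [/\ L1loc D f, L1loc D g & forall phi, test_function D phi ->
    (\int[leb]_(x in D) (f x * partial i phi x)%:E =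
     - \int[leb]_(x in D) (g x * phi x)%:E)%E].

(* A chosen representative of the weak partial derivative, which is unique up
   to null sets; a junk value if there is none. *)
Definition wpartial D i f : 'rV[R]_n -> R :=
  xget (fun=> 0) [set g | weak_partial D i f g].

Definition W12 D f :=
  L2 D f /\ forall i, exists2 g, weak_partial D i f g & L2 D g.

Definition W12_0 D f :=
  W12 D f /\
  exists phi : nat -> 'rV[R]_n -> R,
  [/\ forall k, test_function D (phi k),
      (\int[leb]_(x in D) ((f x - phi k x) ^+ 2)%:E)%E @[k --> \oo] --> 0%E
    & forall i, (\int[leb]_(x in D)
        ((wpartial D i f x - partial i (phi k) x) ^+ 2)%:E)%E @[k --> \oo]
        --> 0%E].

Definition wgrad_sq m D (v : 'rV[R]_n -> 'rV[R]_m) (x : 'rV[R]_n) : R :=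
  \sum_(j < m) \sum_(i < n) wpartial D i (fun y => v y 0 j) x ^+ 2.

Definition cvg_W12loc m (v_ : nat -> 'rV[R]_n -> 'rV[R]_m)
    (v : 'rV[R]_n -> 'rV[R]_m) :=
  forall rho : R, 0 < rho ->
  let B := eball (0 : 'rV[R]_n) rho in
  [/\ forall j, W12 B (fun x => v x 0 j),
      \forall k \near \oo, forall j, W12 B (fun x => v_ k x 0 j)
    & (\int[leb]_(x in B)
        (enorm (v_ k x - v x) ^+ 2 + wgrad_sq B (v_ k \- v) x)%:E)%E
        @[k --> \oo] --> 0%E].

Definition cvg_locally_uniformly m (v_ : nat -> 'rV[R]_n -> 'rV[R]_m)
    (v : 'rV[R]_n -> 'rV[R]_m) :=
  forall K, compact K -> forall e : R, 0 < e ->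
  \forall k \near \oo, forall x, K x -> enorm (v_ k x - v x) < e.

End calculus.

Section hypersurface.
Context (R : realType).

Definition dini_modulus (a : R) (omega : R -> R) :=
  [/\ forall t, 0 <= t <= a -> 0 <= omega t,
      forall s t, 0 <= s -> s <= t -> t <= a -> omega s <= omega t,
      omega 0 = 0
    & (\int[lebesgue_measure]_(t in `[0%R, a]) (omega t / t)%:E < +oo)%E].

Context (n : nat).
Implicit Types (S : set 'rV[R]_n) (x : 'rV[R]_n).

Definition C1_hypersurface S :=
  forall x, S x -> exists (U : set 'rV[R]_n) (phi : 'rV[R]_n -> R),
  [/\ open U, U x, C1_on U phi, forall y, U y -> grad phi y != 0
    & S `&` U = [set y | U y /\ phi y = 0]].

Definition tangent_space S x : set 'rV[R]_n :=
  [set v | exists c : R -> 'rV[R]_n,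
    [/\ c 0 = x, \forall t \near (0 : R), S (c t) & is_derive (0 : R) 1 c v]].

(* The orthonormal system centered at x has the rows of E as its first n - 1
   axes and nu as its last one: (y, t) is the point x + y *m E + t *: nu. *)
Definition C1Dini_graph_at S x :=
  exists (E : 'M[R]_(n.-1, n)) (nu : 'rV[R]_n) (r : R) (omega : R -> R)
         (f : 'rV[R]_n.-1 -> R),
  let B' := eball (0 : 'rV[R]_n.-1) r in
  [/\ [/\ E *m E^T = 1%:M, nu *m nu^T = 1%:M & E *m nu^T = 0],
      tangent_space S x = range (fun y : 'rV[R]_n.-1 => y *m E),
      0 < r /\ dini_modulus (2 * r) omega,
      [/\ C1_on B' f, f 0 = 0, grad f 0 = 0 &
          forall y z, B' y -> B' z ->
            enorm (grad f y - grad f z) <= omega (enorm (y - z))]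
    & S `&` [set x + y *m E + t *: nu | y in B' & t in `]- r, r[] =
      [set x + y *m E + f y *: nu | y in B']].

Definition C1Dini_hypersurface S :=
  [/\ S !=set0, closed S, C1_hypersurface S
    & forall x, S x -> C1Dini_graph_at S x].

End hypersurface.

Section free_boundary.
Context (R : realType) (n m : nat).
Implicit Types (D E Sigma O : set 'rV[R]_n) (gamma eps r : R).
Implicit Types (u v g : 'rV[R]_n -> 'rV[R]_m) (x : 'rV[R]_n) (i j : 'I_m).

Definition Omega D v : set 'rV[R]_n := [set x | D x /\ 0 < enorm (v x)].

Definition Omega_i D v i : set 'rV[R]_n := [set x | D x /\ 0 < v x 0 i].

Definition J Sigma gamma D v E : \bar R :=
  (\int[leb]_(x in E)
     (wgrad_sq D v x + dist_to x Sigma `^ (2 * gamma) * \1_(Omega D v) x)%:E)%E.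

Definition nonneg_ae D v :=
  forall i, {ae (@leb R n), forall x, D x -> 0 <= v x 0 i}.

Definition admissible D g v :=
  [/\ forall i, W12 D (fun x => v x 0 i),
      forall i, W12_0 D (fun x => v x 0 i - g x 0 i)
    & nonneg_ae D v].

(* Includes the choice of the continuous representative in D. *)
Definition local_minimizer Sigma gamma D g eps u :=
  [/\ admissible D g u,
      forall x, D x -> {for x, continuous u}
    & forall v, admissible D g v ->
      (\int[leb]_(x in D) (wgrad_sq D (u \- v) x)%:E +
       \int[leb]_(x in D) `|\1_(Omega D u) x - \1_(Omega D v) x|%:E
         < eps%:E)%E ->
      (J Sigma gamma D u D <= J Sigma gamma D v D)%E].

Definition Gamma_Sigma Sigma D u : set 'rV[R]_n :=
  bdry (Omega D u) `&` Sigma `&` D.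

Definition Theta_is Sigma gamma D u x (theta : R) :=
  (fun r => r `^ (- (n%:R + 2 * gamma)) *
     \int[leb]_(y in eball x r)
       (dist_to y Sigma `^ (2 * gamma) * \1_(Omega D u) y)) @ 0^'+ --> theta.

Definition Gamma_ND Sigma gamma D u : set 'rV[R]_n :=
  [set x | Gamma_Sigma Sigma D u x /\
           exists2 theta, Theta_is Sigma gamma D u x theta & 0 < theta].

Definition comps D u x r : set (set 'rV[R]_n) :=
  let A := Omega D u `&` eball x r in
  [set O | (exists2 y, A y & O = connected_component A y) /\ bdry O x].

Definition I_comp u O : {set 'I_m} :=
  finset (fun i => `[< forall x, O x -> 0 < u x 0 i >]).

Definition I_scale D u x r : {set 'I_m} :=
  finset (fun i => `[< exists2 O, comps D u x r O & i \in I_comp u O >]).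

Definition nonempty_comps Sigma gamma D u (Rx : 'rV[R]_n -> R) :=
  forall x, Gamma_ND Sigma gamma D u x ->
  0 < Rx x /\ forall r, 0 < r < Rx x -> comps D u x r !=set0.

(* The radii rx and index sets I are fixed data, determined by u up to the choice
   of the radii. *)
Definition stable_indices Sigma gamma D u (Rx rx : 'rV[R]_n -> R)
    (I : 'rV[R]_n -> {set 'I_m}) :=
  forall x, Gamma_ND Sigma gamma D u x ->
  [/\ 0 < rx x, 4 * rx x < Num.min (Rx x) (dist_to x (bdry D)), I x != finset.set0
    & forall r, 0 < r < rx x -> I_scale D u x r = I x].

Definition triangle D u i j x r : set 'rV[R]_n :=
  let Bi := bdry (Omega_i D u i) in let Bj := bdry (Omega_i D u j) in
  ((Bi `\` Bj) `|` (Bj `\` Bi)) `&` eball x r.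

Definition Gamma_mp_nb Sigma gamma D u (rx : 'rV[R]_n -> R)
    (I : 'rV[R]_n -> {set 'I_m}) : set 'rV[R]_n :=
  [set x | [/\ Gamma_ND Sigma gamma D u x, (2 <= #|I x|)%N
    & exists2 r, 0 < r < rx x &
      forall i j, i \in I x -> j \in I x -> i != j ->
        triangle D u i j x r = set0]].

Definition rescaling gamma u x r : 'rV[R]_n -> 'rV[R]_m :=
  fun y => r `^ (- (1 + gamma)) *: u (x + r *: y).

(* u is only meaningful in D; for x in D, eventually every bounded set is mapped
   into D by y |-> x + r_k y, so the values of u outside D are irrelevant. *)
Definition blowup_limit gamma u x (u0 : 'rV[R]_n -> 'rV[R]_m) :=
  exists r_ : nat -> R,
  [/\ forall k, 0 < r_ k, r_ k @[k --> \oo] --> (0 : R),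
      cvg_W12loc (fun k => rescaling gamma u x (r_ k)) u0
    & cvg_locally_uniformly (fun k => rescaling gamma u x (r_ k)) u0].

Definition unit_direction (u0 : 'rV[R]_n -> 'rV[R]_m) (a : 'rV[R]_m) :=
  [/\ enorm a = 1, forall i, 0 <= a 0 i & forall x, u0 x = enorm (u0 x) *: a].

Definition spt (a : 'rV[R]_m) : {set 'I_m} := finset (fun i => 0 < a 0 i).

Definition I_blowup (u0 : 'rV[R]_n -> 'rV[R]_m) : {set 'I_m} :=
  finset (fun i => `[< ~ forall x, u0 x 0 i = 0 >]).

End free_boundary.

(* Main.v *)
(* Since a_i > 0 turns u0_i = a_i |u0| into a positive multiple of |u0|, the
   positivity sets of u0_i and |u0| coincide. What remains is that u0 is not
   identically zero: u0 = 0 would make every nonnegative unit vector a direction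
   of u0, which contradicts uniqueness because the multiphase condition forces
   m >= 2. *)
Require Import Defs.
From mathcomp Require Import all_boot all_order all_algebra.
From mathcomp Require Import all_classical all_reals all_analysis.
Import Order.TTheory GRing.Theory Num.Theory.
Import numFieldNormedType.Exports.
Local Open Scope classical_set_scope.
Local Open Scope ring_scope.

Lemma enorm_delta (R : realType) (m : nat) (i : 'I_m) :
  enorm (delta_mx 0 i : 'rV[R]_m) = 1.
Proof.
rewrite /enorm (bigD1 i) //= big1 => [|j ji]; rewrite mxE eqxx /=.
  by rewrite eqxx expr1n addr0 sqrtr1.
by rewrite (negbTE ji) expr0n.
Qed.

(** Supplies the competing directions: for a vanishing map the factorization reads 0 = 0, so only
    the norm and the signs of the vector matter. *)
Lemma unit_direction_delta (R : realType) (n m : nat)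
    (u0 : 'rV[R]_n -> 'rV[R]_m) (i : 'I_m) :
  (forall x, u0 x = 0) ->
  unit_direction u0 (delta_mx 0 i).
Proof.
move=> u00; split=> [|j|x]; first exact: enorm_delta.
  by rewrite mxE ler0n.
rewrite u00 /enorm big1 ?sqrtr0 ?scale0r // => j _.
by rewrite mxE expr0n.
Qed.

(** Two basis vectors compete for the zero map as soon as [m >= 2]. For [m = 1] the conclusion can
    fail, since the zero map then has 1 as its only direction. *)
Lemma unique_unit_direction_neq0 (R : realType) (n m : nat)
    (u0 : 'rV[R]_n -> 'rV[R]_m) (a : 'rV[R]_m) :
  (2 <= m)%N -> unique (unit_direction u0) a -> exists x, enorm (u0 x) != 0.
Proof.
move=> m2 [[_ _ u0E] a_uniq]; apply/not_existsP => v0.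
have {}v0 x : enorm (u0 x) = 0 by apply/eqP/negPn/negP; exact: v0.
have u00 x : u0 x = 0 by rewrite u0E v0 scale0r.
have d i := a_uniq _ (unit_direction_delta _ _ _ _ i u00).
pose i0 := Ordinal (ltnW m2); pose i1 := Ordinal m2.
(* Both basis vectors equal [a]; comparing their entries at [i0] gives 1 = 0. *)
have /matrixP/(_ 0 i0) := etrans (esym (d i0)) (d i1).
by rewrite !mxE eqxx /= => /eqP; rewrite oner_eq0.
Qed.

Lemma Omega_i_direction (R : realType) (n m : nat) (D : set 'rV[R]_n)
    (u0 : 'rV[R]_n -> 'rV[R]_m) (a : 'rV[R]_m) (i : 'I_m) :
  (forall x, u0 x = enorm (u0 x) *: a) -> 0 < a 0 i ->
  Omega_i D u0 i = Omega D u0.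
Proof.
move=> u0E ai; have u0iE x : (0 < u0 x 0 i) = (0 < enorm (u0 x)).
  (* The first rewrite also expands [u0 x] inside the norm on the right; [-u0E] folds it back. *)
  by rewrite u0E mxE pmulr_lgt0// -u0E.
by apply/seteqP; split=> x [Dx]; rewrite ?u0iE => ?; split; rewrite ?u0iE.
Qed.

Theorem corollary1p15 (R : realType) (n m : nat) (gamma : R)
    (D Sigma : set 'rV[R]_n) (g u : 'rV[R]_n -> 'rV[R]_m) (eps0 : R)
    (Rx rx : 'rV[R]_n -> R) (I : 'rV[R]_n -> {set 'I_m})
    (x0 : 'rV[R]_n) (u0 : 'rV[R]_n -> 'rV[R]_m) (a : 'rV[R]_m) :
  (2 <= n)%N -> (1 <= m)%N -> 0 < gamma ->
  open D -> bounded_set D ->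
  C1Dini_hypersurface Sigma ->
  (forall i, W12 D (fun x => g x 0 i)) -> nonneg_ae D g ->
  0 < eps0 -> local_minimizer Sigma gamma D g eps0 u ->
  nonempty_comps Sigma gamma D u Rx ->
  stable_indices Sigma gamma D u Rx rx I ->
  Gamma_mp_nb Sigma gamma D u rx I x0 ->
  blowup_limit gamma u x0 u0 ->
  let v0 := fun x => enorm (u0 x) in
  let Omega0 := Omega setT u0 in
  connected Omega0 ->
  unique (unit_direction u0) a ->
  [/\ I_blowup u0 = spt a,
      forall x, u0 x = v0 x *: a,
      forall i, i \in spt a -> bdry (Omega_i setT u0 i) = bdry Omega0
    & forall i, i \notin spt a -> forall x, u0 x 0 i = 0].
Proof.
move=> _ _ _ _ _ _ _ _ _ _ _ _ [_ I2 _] _ v0 Omega0 _ a_uniq.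
(* The two phases meeting at [x0] are distinct elements of ['I_m]. *)
have m2 : (2 <= m)%N by rewrite (leq_trans I2)// -[leqRHS]card_ord max_card.
have [[_ a_ge0 u0E] _] := a_uniq.
have u0_notin i : i \notin spt a -> forall x, u0 x 0 i = 0.
  rewrite finset.inE lt_neqAle a_ge0 andbT negbK => /eqP ai x.
  by rewrite u0E mxE -ai mulr0.
split=> [|//|i|//].
  apply/finset.setP => i; rewrite finset.inE.
  case: (boolP (i \in spt a)) => [ai|/u0_notin ui0]; last first.
    by apply/asboolP; apply.
  (* If component [i] vanished identically, cancelling [a 0 i > 0] would force the norm of [u0] to
     vanish even at a point where it is nonzero. *)
  apply/asboolP => ui0; move: ai; rewrite finset.inE => ai.
  have [x] := unique_unit_direction_neq0 _ _ _ _ _ m2 a_uniq.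
  move/negP; apply; have /eqP := ui0 x.
  by rewrite u0E mxE mulf_eq0 -u0E (gt_eqF ai) orbF.
by rewrite finset.inE => /(Omega_i_direction _ _ _ setT _ _ _ u0E) ->.
Qed.
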